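(* Let $D$ be an integral domain with quotient field $K$, let $A$ be a finitely generated, torsion-free $D$-algebra (possibly non-commutative), let $B=A\otimes_D K$, and assume that $A\cap K=D$ when $A$ and $K$ are canonically embedded in $B$. Let $S\subseteq A$. Then $S$ is a right ringset if and only if $S$ is a right null-ideal set modulo $dA$ for all non-zero $d\in D$. Similarly, $S$ is a left ringset if and only if $S$ is a left null-ideal set modulo $dA$ for all non-zero $d\in D$.
   Context: Rings are associative with identity, not necessarily commutative (the zero ring is allowed). For a ring $R$, $R[x]$ is the usual polynomial ring, whose indeterminate $x$ commutes with all elements of $R$. A polynomial $f=\sum_k c_kx^k\in R[x]$ induces two functions on $R$: the right polynomial function $f_r(s)=\sum_k c_k s^k$ and the left polynomial function $f_l(s)=\sum_k s^k c_k$. With $D,K,A,B$ as in the claim and $S\subseteq A$, define $$\operatorname{Int}^r_B(S,A)=\{f\in B[x]\mid \forall s\in S:\ f_r(s)\in A\},\qquad \operatorname{Int}^l_B(S,A)=\{f\in B[x]\mid \forall s\in S:\ f_l(s)\in A\}.$$ $S$ is called a right ringset if $\operatorname{Int}^r_B(S,A)$ is closed under multiplication in $B[x]$ (and hence a ring), and a left ringset if $\operatorname{Int}^l_B(S,A)$ is closed under multiplication in $B[x]$ (and hence a ring). For a ring $R$, a subset $S\subseteq R$ and a two-sided ideal $I$ of $R$, let $$N^r_{(R\bmod I)}(S)=\{f\in R[x]\mid \forall s\in S:\ f_r(s)\in I\},\qquad N^l_{(R\bmod I)}(S)=\{f\in R[x]\mid \forall s\in S:\ f_l(s)\in I\}.$$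 The first is always a left ideal of $R[x]$ and the second is always a right ideal of $R[x]$. $S$ is called a right null-ideal set modulo $I$ if $N^r_{(R\bmod I)}(S)$ is a right ideal (hence a two-sided ideal) of $R[x]$, and a left null-ideal set modulo $I$ if $N^l_{(R\bmod I)}(S)$ is a left ideal (hence a two-sided ideal) of $R[x]$. In the claim these notions are used with $R=A$ and $I=dA$. *)

(* Defs.v *)
From HB Require Import structures.
From mathcomp Require Import all_boot all_algebra.
From mathcomp Require Import boolp classical_sets.

Set Implicit Arguments.
Unset Strict Implicit.
Unset Printing Implicit Defensive.

Import GRing.Theory.
Local Open Scope ring_scope.
Local Open Scope classical_set_scope.

Section FractionAlgebra.
Variable D : idomainType.

Definition fraction_scale (d : D) (k : {fraction D}) : {fraction D} := tofrac d * k.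

Fact fraction_scaleA a b k :
  fraction_scale a (fraction_scale b k) = fraction_scale (a * b) k.
Proof. by rewrite /fraction_scale tofracM mulrA. Qed.

Fact fraction_scale1 : left_id 1 fraction_scale.
Proof. by move=> k; rewrite /fraction_scale tofrac1 mul1r. Qed.

Fact fraction_scaleDr : right_distributive fraction_scale +%R.
Proof. by move=> a k l; rewrite /fraction_scale mulrDr. Qed.

Fact fraction_scaleDl k : {morph fraction_scale^~ k : a b / a + b}.
Proof. by move=> a b; rewrite /fraction_scale tofracD mulrDl. Qed.

HB.instance Definition _ := GRing.Zmodule_isLmodule.Build D {fraction D}
  fraction_scaleA fraction_scale1 fraction_scaleDr fraction_scaleDl.

Fact fraction_scaleAl (d : D) (k l : {fraction D}) : d *: (k * l) = d *: k * l.
Proof. exact: mulrA. Qed.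

HB.instance Definition _ :=
  GRing.Lmodule_isLalgebra.Build D {fraction D} fraction_scaleAl.
HB.instance Definition _ :=
  GRing.Lalgebra_isComAlgebra.Build D {fraction D}.

End FractionAlgebra.

(* Tensor products are given up to isomorphism, by their universal property;
   [t m n] is the pure tensor of [m] and [n]. *)
Definition is_tensor_product (R : comNzRingType) (M N T : lmodType R)
    (t : M -> N -> T) : Prop :=
  bilinear_for *:%R *:%R t /\
  forall (P : lmodType R) (f : M -> N -> P), bilinear_for *:%R *:%R f ->
    exists g : {linear T -> P},
      (forall m n, g (t m n) = f m n) /\
      (forall h : {linear T -> P}, (forall m n, h (t m n) = f m n) -> h =1 g).

Definition is_tensor_algebra (R : comNzRingType) (A C B : algType R)
    (t : A -> C -> B) : Prop :=
  [/\ is_tensor_product t,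
      t 1 1 = 1 &
      forall a a' c c', t a c * t a' c' = t (a * a') (c * c')].

Definition torsion_free (D : idomainType) (M : lmodType D) : Prop :=
  forall (d : D) (m : M), d *: m = 0 -> d = 0 \/ m = 0.

(* Finite generation as an algebra: a finite subset of [A] lies in no proper
   subalgebra. *)
Definition finitely_generated_algebra (R : comNzRingType) (A : algType R) : Prop :=
  exists s : seq A, forall P : {pred A},
    GRing.subalg_closed P -> {subset s <= P} -> forall a, a \in P.

(* The right polynomial function of [f] is [horner f], which keeps the
   coefficients on the left of the powers of the argument. *)
Definition left_horner (R : nzRingType) (f : {poly R}) (s : R) : R :=
  \sum_(k < size f) s ^+ k * f`_k.

Section IntegerValued.
Variables (A B : nzRingType) (i : A -> B) (S : set A).

(* [A] is viewed inside [B] through [i]. *)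
Definition Int_r : set {poly B} :=
  [set f | forall s, S s -> range i f.[i s]].

Definition Int_l : set {poly B} :=
  [set f | forall s, S s -> range i (left_horner f (i s))].

Definition right_ringset : Prop :=
  forall f g, Int_r f -> Int_r g -> Int_r (f * g).

Definition left_ringset : Prop :=
  forall f g, Int_l f -> Int_l g -> Int_l (f * g).

End IntegerValued.

Definition is_right_ideal (R : nzRingType) (J : set R) : Prop :=
  [/\ J 0, forall x y, J x -> J y -> J (x - y) & forall x r, J x -> J (x * r)].

Definition is_left_ideal (R : nzRingType) (J : set R) : Prop :=
  [/\ J 0, forall x y, J x -> J y -> J (x - y) & forall x r, J x -> J (r * x)].

Section NullPolynomials.
Variables (R : nzRingType) (I S : set R).

Definition null_r : set {poly R} := [set f | forall s, S s -> I f.[s]].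

Definition null_l : set {poly R} :=
  [set f | forall s, S s -> I (left_horner f s)].

Definition right_null_ideal_set : Prop := is_right_ideal null_r.

Definition left_null_ideal_set : Prop := is_left_ideal null_l.

End NullPolynomials.

Definition scalar_ideal (D : idomainType) (A : algType D) (d : D) : set A :=
  range (fun a : A => d *: a).
Arguments scalar_ideal {D} A d.

(* Main.v *)
(* Writing [f = h / d] with [h] in [A[x]], integer-valuedness of [f] on [S] says
   that [h] lies in the null ideal of [S] modulo [dA].  Multiplying [f] by
   polynomials of [A[x]], which are integer-valued, turns the ringset property
   into the null-ideal property.  Conversely [(f g)(s) = (f a)(s)] for the
   constant [a = g(s)] of [A], so the ideal property applied to [h] and [a] makes
   [f g] integer-valued.  All that is needed of [B] is that [A] embeds in it, that
   nonzero elements of [D] become invertible, and that every element of [B] has a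
   denominator in [D]; the embedding and the denominators are obtained by
   testing the universal property of [B] on suitable quotient modules. *)
Require Import Defs.
From HB Require Import structures.
From mathcomp Require Import all_boot all_algebra.
From mathcomp Require Import generic_quotient ring_quotient.
From mathcomp Require Import boolp classical_sets functions.
From mathcomp Require Import ring.

Set Implicit Arguments.
Unset Strict Implicit.
Unset Printing Implicit Defensive.

Import GRing.Theory.
Local Open Scope ring_scope.
Local Open Scope quotient_scope.
Local Open Scope classical_set_scope.

(** * Quotient modules *)

Lemma exists_quotient_lmod (R : nzRingType) (U : lmodType R) (W : {pred U}) :
    GRing.submod_closed W ->
  exists (V : lmodType R) (p : {linear U -> V}), forall u, p u = 0 <-> u \in W.
Proof.
move=> W_submod.
pose W_zmod := GRing.isZmodClosed.Build U W (GRing.submod_closedB W_submod).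
pose I : zmodClosed U := HB.pack W W_zmod.
have scaleW a u : u \in W -> a *: u \in W.
  by move=> Wu; rewrite -[_ *: u]addr0 W_submod.2 ?W_submod.1.
pose Q := Quotient.quot I.
have pi_eq u v : (\pi_Q u == \pi_Q v) = (u - v \in W).
  exact: esym (Quotient.idealrBE I u v).
(* Scaling a representative is independent of its choice because [W] absorbs scalars. *)
have repr_scale a u : \pi_Q (a *: repr (\pi_Q u)) = \pi_Q (a *: u) :> Q.
  by apply/eqP; rewrite pi_eq -scalerBr scaleW // -pi_eq reprK.
pose scale a (q : Q) : Q := \pi_Q (a *: repr q).
have scalepi a u : scale a (\pi_Q u) = \pi_Q (a *: u) by exact: repr_scale.
have scaleA a b q : scale a (scale b q) = scale (a * b) q.
  by elim/quotW: q => u; rewrite !scalepi scalerA.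
have scale1 : left_id 1 scale.
  by elim/quotW=> u; rewrite scalepi scale1r.
have scaleDr : right_distributive scale +%R.
  move=> a; elim/quotW=> u; elim/quotW=> v.
  by rewrite -raddfD !scalepi -raddfD scalerDr.
have scaleDl q : {morph scale^~ q : a b / a + b}.
  by elim/quotW: q => u a b; rewrite !scalepi -raddfD scalerDl.
pose Q_lmod := GRing.Zmodule_isLmodule.Build R Q scaleA scale1 scaleDr scaleDl.
pose V : lmodType R := HB.pack Q Q_lmod.
have pi_linear : linear (\pi_Q : U -> V).
  move=> a u v.
  by rewrite -[RHS]/(scale a (\pi_Q u) + \pi_Q v) scalepi -raddfD.
pose p_linear := GRing.isLinear.Build R U V *:%R _ pi_linear.
pose p : {linear U -> V} := HB.pack (\pi_Q : U -> V) p_linear.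
exists V, p.
move=> u /=; rewrite -[u in u \in W]subr0 -pi_eq raddf0.
by split=> [->|/eqP].
Qed.

Lemma fraction_denominator (D : idomainType) (k : {fraction D}) :
  exists2 d : D, d != 0 & exists c, tofrac c = tofrac d * k.
Proof.
elim/quotW: k => x; exists \d_x; first exact: denom_ratioP.
exists \n_x; unlock tofrac; rewrite -[RHS]FracField.pi_mul /FracField.mulf.
rewrite !numden_Ratio ?oner_neq0 // mul1r; apply/eqmodP => /=.
rewrite FracField.equivfE !numden_Ratio ?oner_neq0 ?denom_ratioP ?mul1r //.
by rewrite mulrC.
Qed.

(** * Tensor products with the fraction field: denominators and torsion *)

Section FractionTensor.
Variables (D : idomainType) (M T : lmodType D) (t : M -> {fraction D} -> T).
Hypothesis t_tensor : is_tensor_product t.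

Lemma tensor_scaler d m k : t m (tofrac d * k) = d *: t m k.
Proof. by have [[_ tr] _] := t_tensor; apply: (scalable_linear (tr m)). Qed.

Lemma tensor_scalel d m k : t (d *: m) k = d *: t m k.
Proof. by have [[tl _] _] := t_tensor; apply: (scalable_linear (tl k)). Qed.

(** The elements with a denominator form a submodule [W] containing every pure tensor. The
    projection onto the quotient by [W] and the zero map thus agree on pure tensors, so they are
    equal by uniqueness in the universal property. *)
Lemma tensor_common_denominator (x : T) :
  exists2 d : D, d != 0 & exists m, d *: x = t m 1.
Proof.
have [[tl tr] t_univ] := t_tensor.
pose W : {pred T} :=
  fun x => `[< exists2 d : D, d != 0 & exists m, d *: x = t m 1 >].
have W_submod : GRing.submod_closed W.
  split.
    apply/asboolP; exists 1; rewrite ?oner_neq0 //; exists 0.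
    by rewrite scaler0 -[0 in RHS](scale0r (0 : M)) tensor_scalel scale0r.
  move=> a u v /asboolP[d d0 [m dm]] /asboolP[e e0 [n en]]; apply/asboolP.
  exists (d * e); first by rewrite mulf_neq0.
  exists ((a * e) *: m + d *: n).
  rewrite tl /= tensor_scalel -dm -en scalerDr !scalerA; congr (_ *: _ + _).
  by rewrite mulrC [d * e]mulrC mulrA.
have [V [p pE]] := exists_quotient_lmod W_submod.
have p_t m k : p (t m k) = 0.
  apply/pE/asboolP; have [d d0 [c ck]] := fraction_denominator k.
  exists d => //; exists (c *: m).
  by rewrite -tensor_scaler -ck tensor_scalel -tensor_scaler mulr1.
have zero_bilinear :
    bilinear_for *:%R *:%R (fun (_ : M) (_ : {fraction D}) => 0 : V).
  by split=> [k|m] a u v; rewrite /= scaler0 addr0.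
have [g [_ g_uniq]] := t_univ V _ zero_bilinear.
have /pE /asboolP // : p x = 0.
by rewrite (g_uniq p) // -(g_uniq \0).
Qed.

(** The product [d k] when it lies in [D], and the default 0 otherwise. The default never occurs
    when [d] is a multiple of a denominator of [k]. *)
Definition scaled_numer (d : D) (k : {fraction D}) : D :=
  xget 0 [set c | tofrac c = tofrac d * k].

Lemma scaled_numerE d k c : tofrac c = tofrac d * k -> scaled_numer d k = c.
Proof.
move=> ck; apply: xget_subset1 => // a b /= ak bk.
by apply/eqP; rewrite -tofrac_eq ak bk.
Qed.

(* The bilinear map sending [m, k] to the germ of [d |-> (d k) m] for the
   filter generated by the sets of multiples of nonzero scalars kills [m, 1]
   only when some nonzero scalar kills [m]. *)
Lemma tensor_torsion_free_inj (m : M) : torsion_free M -> t m 1 = 0 -> m = 0.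
Proof.
move=> M_tf tm0; have [[tl tr] t_univ] := t_tensor.
pose W : {pred D -> M} :=
  (* The functions with zero germ. *)
  fun u => `[< exists2 e : D, e != 0 & forall c, u (e * c) = 0 >].
have W_submod : GRing.submod_closed W.
  split; first by apply/asboolP; exists 1; rewrite ?oner_neq0.
  move=> a u v /asboolP[d d0 ud] /asboolP[e e0 ve]; apply/asboolP.
  exists (d * e) => [|c]; first by rewrite mulf_neq0.
  by rewrite !fctE -mulrA ud scaler0 add0r mulrCA ve.
have [V [p pE]] := exists_quotient_lmod W_submod.
pose f (m : M) k := p (fun d => scaled_numer d k *: m).
have f_bilinear : bilinear_for *:%R *:%R f.
  split=> [k a u v|u a k l]; rewrite /f /= -linearP.
    congr (p _); apply/funext => d; rewrite !fctE /=.
    by rewrite scalerDr !scalerA mulrC.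
  (* Linearity in the fraction holds only for germs: on multiples of [d * e], with [d] and [e]
     denominators of [k] and [l], all three numerators are genuine. *)
  apply/eqP; rewrite -subr_eq0 -raddfB; apply/eqP/pE/asboolP.
  have [d d0 [x xk]] := fraction_denominator k.
  have [e e0 [y yl]] := fraction_denominator l.
  exists (d * e) => [|c]; first by rewrite mulf_neq0.
  have xE : tofrac (x * (e * c)) = tofrac (d * e * c) * k.
    by rewrite !tofracM xk; ring.
  have yE : tofrac (y * (d * c)) = tofrac (d * e * c) * l.
    by rewrite !tofracM yl; ring.
  have zE : tofrac (a * (x * (e * c)) + y * (d * c))
          = tofrac (d * e * c) * (a *: k + l).
    rewrite tofracD [tofrac (a * _)]tofracM xE yE mulrDr; congr (_ + _).
    by rewrite -[a *: k]/(tofrac a * k) mulrCA.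
  rewrite !fctE (scaled_numerE zE) (scaled_numerE xE) (scaled_numerE yE).
  by rewrite scalerDl scalerA subrr.
have [g [g_t _]] := t_univ V f f_bilinear.
have /esym := g_t m 1; rewrite tm0 raddf0 => /pE /asboolP[e e0 /(_ 1)].
(* At the multiple [e * 1], the vanishing germ reads [e *: m = 0]. *)
rewrite (@scaled_numerE _ _ e) ?mulr1 // => /M_tf[eq0|//].
by rewrite eq0 eqxx in e0.
Qed.

End FractionTensor.

(** * Left and right evaluation of polynomials *)

Section LeftHorner.
Variable R : nzRingType.
Implicit Types f g : {poly R}.

Lemma left_horner_wide n f s :
  (size f <= n)%N -> left_horner f s = \sum_(k < n) s ^+ k * f`_k.
Proof.
move=> le_n; rewrite /left_horner (big_ord_widen n (fun k => s ^+ k * f`_k)) //.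
rewrite big_mkcond /=; apply: eq_bigr => k _; case: ltnP => // le_k.
by rewrite nth_default ?mulr0.
Qed.

Lemma left_hornerD f g s :
  left_horner (f + g) s = left_horner f s + left_horner g s.
Proof.
pose n := maxn (size f) (size g).
rewrite !(@left_horner_wide n) ?leq_maxl ?leq_maxr ?size_polyD // -big_split /=.
by apply: eq_bigr => k _; rewrite coefD mulrDr.
Qed.

Lemma left_horner0 (s : R) : left_horner 0 s = 0.
Proof. by rewrite /left_horner size_poly0 big_ord0. Qed.

Lemma left_hornerC (c s : R) : left_horner c%:P s = c.
Proof.
rewrite (@left_horner_wide 1) ?size_polyC ?leq_b1 // big_ord1 expr0 mul1r.
by rewrite coefC.
Qed.

Lemma left_hornerN f s : left_horner (- f) s = - left_horner f s.
Proof.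
by apply/eqP; rewrite -addr_eq0 -left_hornerD addNr left_horner0.
Qed.

Lemma left_hornerMX f s : left_horner (f * 'X) s = s * left_horner f s.
Proof.
rewrite (@left_horner_wide (size f).+1) ?size_polyMX_leq //; last first.
  by rewrite (leq_trans (size_polyMleq _ _)) // size_polyX addn2.
rewrite big_ord_recl coefMX /= mulr0 add0r /left_horner mulr_sumr.
by apply: eq_bigr => k _; rewrite coefMX /= exprS mulrA.
Qed.

Lemma left_hornerMC f c s : left_horner (f * c%:P) s = left_horner f s * c.
Proof.
rewrite (@left_horner_wide (size f)); last first.
  by apply/leq_sizeP => j le_j; rewrite coefMC nth_default ?mul0r.
by rewrite /left_horner mulr_suml; apply: eq_bigr => k _; rewrite coefMC mulrA.
Qed.

(** Grouping the terms [s ^+ (j + k) * f_j * g_k] by [k] gives [s ^+ k * (f(s) * g_k)], where [f(s)]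
    is the left value. *)
Lemma left_hornerM f g s :
  left_horner (f * g) s = left_horner ((left_horner f s)%:P * g) s.
Proof.
elim/poly_ind: g => [|g c IHg]; first by rewrite !mulr0.
rewrite !mulrDr !left_hornerD !mulrA !left_hornerMX IHg.
by rewrite !left_hornerMC left_hornerC.
Qed.

Lemma hornerM_value f g s : (f * g).[s] = (f * (g.[s])%:P).[s].
Proof.
elim/poly_ind: f => [|f c IHf]; first by rewrite !mul0r.
rewrite !mulrDl !hornerD -!mulrA -!commr_polyX !mulrA !hornerMX IHf.
by rewrite !hornerCM hornerC.
Qed.

End LeftHorner.

Lemma left_horner_map (R R' : nzRingType) (i : {rmorphism R -> R'}) f s :
  left_horner (map_poly i f) (i s) = i (left_horner f s).
Proof.
rewrite (@left_horner_wide _ (size f)) ?size_poly // /left_horner rmorph_sum.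
by apply: eq_bigr => k _; rewrite coef_map rmorphM rmorphXn.
Qed.

(** Polynomials over [R] are scaled by elements of [R], so [d] acts through the central element
    [d%:A]. *)
Lemma left_hornerZ (D : nzRingType) (R : algType D) d (f : {poly R}) s :
  left_horner (d%:A *: f) s = d *: left_horner f s.
Proof.
rewrite (@left_horner_wide _ (size f)); last first.
  by apply/leq_sizeP => j le_j; rewrite coefZ nth_default ?mulr0.
rewrite /left_horner scaler_sumr.
by apply: eq_bigr => k _; rewrite coefZ mulr_algl scalerAr.
Qed.

Lemma hornerZ_alg (D : nzRingType) (R : algType D) d (f : {poly R}) s :
  (d%:A *: f).[s] = d *: f.[s].
Proof. by rewrite hornerZ mulr_algl. Qed.

Lemma scalar_ideal0 (D : idomainType) (A : algType D) (d : D) :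
  scalar_ideal A d 0.
Proof. by exists 0; rewrite ?scaler0. Qed.

Lemma scalar_idealB (D : idomainType) (A : algType D) (d : D) x y :
  scalar_ideal A d x -> scalar_ideal A d y -> scalar_ideal A d (x - y).
Proof. by move=> [a _ <-] [b _ <-]; exists (a - b); rewrite ?scalerBr. Qed.

(** * Ringsets and null ideals over a localization *)

Section Localization.
Variables (D : idomainType) (A B : algType D) (i : {lrmorphism A -> B}).
Hypothesis i_inj : injective i.
Hypothesis i_denom :
  forall b, exists2 d : D, d != 0 & exists a, d *: b = i a.
Hypothesis i_inv : forall d : D, d != 0 -> exists u : B, d *: u = 1.
Variable S : set A.

Lemma localization_scaleI (d : D) (b b' : B) :
  d != 0 -> d *: b = d *: b' -> b = b'.
Proof.
move=> /i_inv[u du] /(congr1 ( *%R u)).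
by rewrite -!scalerAr !scalerAl du !mul1r.
Qed.

(** Here [b] is the fraction [a / d]. Injectivity of [i] lifts the equation to [A]; invertibility of
    [d] in [B] gives the converse. *)
Lemma range_scalar_ideal d a b :
  d != 0 -> d *: b = i a -> range i b <-> scalar_ideal A d a.
Proof.
move=> d0 db; split=> [[a' _ a'b]|[a' _ a'b]]; exists a' => //.
  by apply: i_inj; rewrite linearZ /= a'b.
by apply: (localization_scaleI d0); rewrite db -a'b linearZ.
Qed.

Lemma poly_common_denominator (f : {poly B}) :
  exists2 d : D, d != 0 & exists h, d%:A *: f = map_poly i h.
Proof.
elim/poly_ind: f => [|f c [d d0 [h fh]]].
  by exists 1; rewrite ?oner_neq0 //; exists 0; rewrite scaler0 rmorph0.
have [e e0 [a ca]] := i_denom c.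
exists (e * d); first by rewrite mulf_neq0.
exists (e%:A *: h * 'X + (d *: a)%:P).
rewrite rmorphD rmorphM /= map_polyX map_polyC map_polyZ /= -fh.
rewrite [i (d *: a)]linearZ /= -ca.
rewrite rmorph_alg scalerDr; congr (_ + _).
  by rewrite scalerA -scalerAl mulr_algl scalerA.
by rewrite -mul_polyC -polyCM mulr_algl scalerA mulrC.
Qed.

Lemma poly_division d (h : {poly A}) :
  d != 0 -> exists f, d%:A *: f = map_poly i h.
Proof.
move=> /i_inv[u du]; exists (u *: map_poly i h).
by rewrite scalerA mulr_algl du scale1r.
Qed.

Lemma Int_r_null_r d f h :
  d != 0 -> d%:A *: f = map_poly i h ->
  Int_r i S f <-> null_r (scalar_ideal A d) S h.
Proof.
move=> d0 fh.
have val_fh s : d *: f.[i s] = i h.[s] by rewrite -hornerZ_alg fh horner_map.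
by split=> Sf s /Sf; apply range_scalar_ideal.
Qed.

Lemma Int_l_null_l d f h :
  d != 0 -> d%:A *: f = map_poly i h ->
  Int_l i S f <-> null_l (scalar_ideal A d) S h.
Proof.
move=> d0 fh.
have val_fh s : d *: left_horner f (i s) = i (left_horner h s).
  by rewrite -left_hornerZ fh left_horner_map.
by split=> Sf s /Sf; apply range_scalar_ideal.
Qed.

Lemma right_ringsetP :
  right_ringset i S <->
  forall d, d != 0 -> right_null_ideal_set (scalar_ideal A d) S.
Proof.
split=> [S_ring d d0|S_null f g Sf Sg s Ss].
  split=> [s _|f g Sf Sg s Ss|h r Sh].
  - by rewrite horner0; apply: scalar_ideal0.
  - by rewrite hornerD hornerN; apply: scalar_idealB; [apply: Sf|apply: Sg].
  have [f fh] := poly_division h d0.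
  (* With [f = h / d], the product [h * r] is the numerator of [f * r] over the same [d]. *)
  apply/(Int_r_null_r (f := f * map_poly i r) d0).
    by rewrite scalerAl fh rmorphM.
  apply: S_ring; first exact/(Int_r_null_r d0 fh).
  by move=> s _; rewrite horner_map; exists r.[s].
rewrite hornerM_value; have [a _ <-] := Sg s Ss.
(* Only [f] needs a denominator: the other factor is now the constant [a] of [A]. *)
have [d d0 [h fh]] := poly_common_denominator f.
have /(Int_r_null_r (f := f * (i a)%:P) d0) :
    null_r (scalar_ideal A d) S (h * a%:P).
  by have [_ _] := S_null d d0; apply; apply/(Int_r_null_r d0 fh).
by apply=> //; rewrite scalerAl fh rmorphM /= map_polyC.
Qed.

Lemma left_ringsetP :
  left_ringset i S <->
  forall d, d != 0 -> left_null_ideal_set (scalar_ideal A d) S.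
Proof.
(* The denominator now belongs to the right factor, and centrality of [d%:A] moves it past the left
   one. *)
have scaleAr d (f g : {poly B}) : d%:A *: (f * g) = f * (d%:A *: g).
  apply/polyP=> k; rewrite coefZ !coefM mulr_sumr; apply: eq_bigr => j _.
  by rewrite coefZ !mulr_algl scalerAr.
split=> [S_ring d d0|S_null f g Sf Sg s Ss].
  split=> [s _|f g Sf Sg s Ss|h r Sh].
  - by rewrite left_horner0; apply: scalar_ideal0.
  - rewrite left_hornerD left_hornerN.
    by apply: scalar_idealB; [apply: Sf|apply: Sg].
  have [f fh] := poly_division h d0.
  apply/(Int_l_null_l (f := map_poly i r * f) d0).
    by rewrite scaleAr fh rmorphM.
  apply: S_ring; last exact/(Int_l_null_l d0 fh).
  by move=> s _; rewrite left_horner_map; exists (left_horner r s).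
(* On this side it is the left factor that is replaced by its value. *)
rewrite left_hornerM; have [a _ <-] := Sf s Ss.
have [d d0 [h gh]] := poly_common_denominator g.
have /(Int_l_null_l (f := (i a)%:P * g) d0) :
    null_l (scalar_ideal A d) S (a%:P * h).
  by have [_ _] := S_null d d0; apply; apply/(Int_l_null_l d0 gh).
by apply=> //; rewrite scaleAr gh rmorphM /= map_polyC.
Qed.

End Localization.

(** * The tensor algebra as a localization *)

Theorem theorem2p7 (D : idomainType) (A B : algType D)
    (t : A -> {fraction D} -> B) (S : set A)
    (A_fg : finitely_generated_algebra A)
    (A_tf : torsion_free A)
    (B_tensor : is_tensor_algebra t)
    (A_cap_K : range (fun a : A => t a 1) `&` range (fun k : {fraction D} => t 1 k)
               = range (fun d : D => d%:A : B)) :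
  (right_ringset (fun a : A => t a 1) S <->
     forall d : D, d != 0 -> right_null_ideal_set (scalar_ideal A d) S) /\
  (left_ringset (fun a : A => t a 1) S <->
     forall d : D, d != 0 -> left_null_ideal_set (scalar_ideal A d) S).
Proof.
have [tP t11 tM] := B_tensor.
have i_linear : linear (fun a : A => t a 1) by case: (tP.1).
have i_mul : monoid_morphism (fun a : A => t a 1).
  by split=> // a b; rewrite tM mulr1.
pose i : {lrmorphism A -> B} :=
  HB.pack (fun a : A => t a 1) (GRing.isLinear.Build D A B *:%R _ i_linear)
    (GRing.isMonoidMorphism.Build A B _ i_mul).
have i_inj : injective i.
  by apply: raddf_inj => a; apply: tensor_torsion_free_inj.
have i_denom b : exists2 d : D, d != 0 & exists a, d *: b = i a.
  exact: tensor_common_denominator.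
have i_inv d : d != 0 -> exists u : B, d *: u = 1.
  (* The inverse of [d] is the pure tensor of 1 and [1 / d]. *)
  move=> d0; exists (t 1 (tofrac d)^-1).
  by rewrite -tensor_scaler // mulfV ?tofrac_eq0.
split; first exact: (right_ringsetP i_inj i_denom i_inv).
exact: (left_ringsetP i_inj i_denom i_inv).
Qed.
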